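(* Let $G$ be a finite group. The minimal height of a finite $T_0$ topological space $X$ with $\mathrm{Aut}(X)\cong G$ is $1$, unless $G$ is isomorphic to a symmetric group $S_k$ for some $k\geq 1$, in which case $G$ can be realized by a space of height $0$ (so the minimal height is $0$). The same statement holds with $\mathcal{E}(X)\cong G$ in place of $\mathrm{Aut}(X)\cong G$.
   Context: For a topological space $X$, $\mathrm{Aut}(X)$ denotes the group of self-homeomorphisms of $X$ under composition, and $\mathcal{E}(X)$ denotes the group of (unpointed) homotopy classes of self-homotopy equivalences of $X$ under composition. Spaces are nonempty. A finite $T_0$ topological space $X$ is identified with a finite poset: for $x\in X$ let $U_x$ be the intersection of all open sets containing $x$, and put $x\leq y$ if and only if $U_x\subseteq U_y$. Under this identification continuous maps are exactly the order-preserving maps. The height $\mathrm{ht}(X)$ is one less than the maximum number of elements in a chain of $X$. *)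

(* Defs.v *)
From HB Require Import structures.
From mathcomp Require Import all_boot all_order all_algebra all_fingroup.
From mathcomp Require Import all_classical all_reals all_analysis.
From mathcomp Require Import generic_quotient lra.

Set Implicit Arguments.
Unset Strict Implicit.
Unset Printing Implicit Defensive.

Import Order.TTheory GRing.Theory Num.Theory numFieldNormedType.Exports.

Local Open Scope classical_set_scope.
Local Open Scope quotient_scope.

#[short(type="finTopologicalType")]
HB.structure Definition FinTopological := {X of Finite X & Topological X}.

Definition isomorphic (H K : groupType) : Prop :=
  exists f : {multiplicative H -> K}, bijective f.

(* U_x, the intersection of all open sets containing x. It is itself open when
   X is finite, and spec_le is then a partial order exactly when X is T0. *)
Definition min_open (X : topologicalType) (x : X) : set X :=
  \bigcap_(U in [set U : set X | open U /\ U x]) U.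

Definition spec_le (X : topologicalType) (x y : X) : Prop :=
  min_open x `<=` min_open y.

Definition chain (X : finTopologicalType) (A : {set X}) : Prop :=
  {in A &, forall x y, spec_le x y \/ spec_le y x}.

Definition ht (X : finTopologicalType) : nat :=
  (\max_(A : {set X} | `[< chain A >]) #|A|).-1.

(* n is the minimal height of a nonempty finite T0 space satisfying P. *)
Definition min_height (P : finTopologicalType -> Prop) (n : nat) : Prop :=
  (exists X : finTopologicalType,
     [/\ kolmogorov_space X, [set: X] !=set0, P X & ht X = n]) /\
  (forall X : finTopologicalType,
     kolmogorov_space X -> [set: X] !=set0 -> P X -> (n <= ht X)%N).

Section IsHomeo.
Context {X : topologicalType}.

Definition is_homeo (f : X -> X) : Prop :=
  continuous f /\
  exists g : X -> X, [/\ continuous g, cancel f g & cancel g f].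

Lemma is_homeo_id : is_homeo id.
Proof.
by split; [move=> x; exact: cvg_id|exists id; split=> // x; exact: cvg_id].
Qed.

Lemma is_homeo_comp f g : is_homeo f -> is_homeo g -> is_homeo (f \o g).
Proof.
move=> [cf [f' [cf' fK f'K]]] [cg [g' [cg' gK g'K]]]; split.
  by move=> x; apply: continuous_comp; [exact: cg|exact: cf].
exists (g' \o f'); split=> [x|x|x] /=.
- by apply: continuous_comp; [exact: cf'|exact: cg'].
- by rewrite fK gK.
- by rewrite g'K f'K.
Qed.

Lemma is_homeo_inv (f : X -> X) : is_homeo f ->
  exists2 g : X -> X, is_homeo g & cancel f g /\ cancel g f.
Proof. by move=> [cf [g [cg fK gK]]]; exists g => //; split=> //; exists f. Qed.

End IsHomeo.

(* Aut(X); the name Aut is taken by the automorphisms of finite groups. The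
   product f * g below is the composite f \o g. *)
Definition Homeo (X : topologicalType) : Type :=
  {f : X -> X | f \in [set f | is_homeo f]}.

Section HomeoGroup.
Variable X : topologicalType.

HB.instance Definition _ := Choice.on (Homeo X).

Lemma HomeoP (f : Homeo X) : is_homeo (val f).
Proof. by have := valP f; rewrite inE. Qed.

Definition mkHomeo (f : X -> X) (hf : is_homeo f) : Homeo X := exist _ f (mem_set hf).

Lemma Homeo_eq (f g : Homeo X) : val f =1 val g -> f = g.
Proof. by move=> fg; apply: val_inj; apply/funext. Qed.

Definition homeo_one : Homeo X := mkHomeo is_homeo_id.
Definition homeo_mul (f g : Homeo X) : Homeo X :=
  mkHomeo (is_homeo_comp (HomeoP f) (HomeoP g)).
Definition homeo_inv (f : Homeo X) : Homeo X :=
  mkHomeo (s2valP (cid2 (is_homeo_inv (HomeoP f)))).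

Lemma homeo_mulA : associative homeo_mul.
Proof. by move=> f g h; apply: Homeo_eq. Qed.
Lemma homeo_mul1 : left_id homeo_one homeo_mul.
Proof. by move=> f; apply: Homeo_eq. Qed.
Lemma homeo_mulr1 : right_id homeo_one homeo_mul.
Proof. by move=> f; apply: Homeo_eq. Qed.
Lemma homeo_mulV : left_inverse homeo_one homeo_inv homeo_mul.
Proof. by move=> f; apply: Homeo_eq => x /=; case: cid2 => g /= _ []. Qed.
Lemma homeo_mulrV : right_inverse homeo_one homeo_inv homeo_mul.
Proof. by move=> f; apply: Homeo_eq => x /=; case: cid2 => g /= _ []. Qed.

HB.instance Definition _ :=
  isGroup.Build (Homeo X) homeo_mulA homeo_mul1 homeo_mulr1 homeo_mulV homeo_mulrV.

End HomeoGroup.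

Section Homotopy.
Local Open Scope ring_scope.
Variable R : realType.

(* A homotopy is continuous on X * [0, 1] for the subspace topology; its values
   outside this strip are irrelevant. *)
Definition homotopic (X Y : topologicalType) (f g : X -> Y) : Prop :=
  exists H : X * R -> Y,
    [/\ {within [set p : X * R | 0 <= p.2 <= 1], continuous H},
        forall x, H (x, 0) = f x & forall x, H (x, 1) = g x].

Lemma continuous_pair (T U V : topologicalType) (f : T -> U) (g : T -> V) :
  continuous f -> continuous g -> continuous (fun x => (f x, g x)).
Proof. by move=> cf cg p; exact: (cvg_pair (cf p) (cg p)). Qed.

Lemma continuous_compT (T U V : topologicalType) (f : T -> U) (g : U -> V) :
  continuous f -> continuous g -> continuous (g \o f).
Proof. by move=> cf cg x; apply: continuous_comp; [exact: cf|exact: cg]. Qed.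

Lemma continuous_fst (T U : topologicalType) : continuous (@fst T U).
Proof. by move=> p; exact: cvg_fst. Qed.

Lemma continuous_snd (T U : topologicalType) : continuous (@snd T U).
Proof. by move=> p; exact: cvg_snd. Qed.

Lemma within_comp (T U V : topologicalType) (A : set T) (B : set U)
    (h : T -> U) (H : U -> V) :
  continuous h -> (forall x, A x -> B (h x)) ->
  {within B, continuous H} -> {within A, continuous (H \o h)}.
Proof.
move=> ch AB /(@subspace_continuousP _ B) cH.
apply/(@subspace_continuousP _ A) => x Ax.
move=> W /= /(cH (h x) (AB x Ax)) HW.
apply: (@filterS _ (nbhs x) _ _ _ _ (ch x _ HW)) => z /= hz Az.
by apply: hz; exact: AB.
Qed.

Lemma comp_within (T U V : topologicalType) (A : set T)
    (H : T -> U) (h : U -> V) :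
  continuous h -> {within A, continuous H} -> {within A, continuous (h \o H)}.
Proof.
by move=> ch cH x W hW; exact: (cH x _ (ch _ _ hW)).
Qed.

Lemma homotopic_refl (X Y : topologicalType) (f : X -> Y) :
  continuous f -> homotopic f f.
Proof.
move=> cf; exists (f \o fst); split=> //.
apply: continuous_subspaceT.
exact: (continuous_compT (@continuous_fst X R) cf).
Qed.

Lemma continuous_reparam (X : topologicalType) (a b : R) :
  continuous (fun p : X * R => (p.1, a * p.2 + b)).
Proof.
have caff : continuous (fun t : R => a * t + b).
  move=> t; apply: (@cvgD _ R _ (nbhs t)); last exact: cvg_cst.
  by apply: (@cvgM _ _ (nbhs t)); [exact: cvg_cst|exact: cvg_id].
apply: continuous_pair; first exact: continuous_fst.
exact: (continuous_compT (@continuous_snd X R) caff).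
Qed.

Lemma homotopic_sym (X Y : topologicalType) (f g : X -> Y) :
  homotopic f g -> homotopic g f.
Proof.
move=> [H [cH H0 H1]]; exists (H \o (fun p => (p.1, -1 * p.2 + 1))); split.
- apply: within_comp cH; first exact: continuous_reparam.
  by move=> [x t] /= /andP[? ?]; apply/andP; split; lra.
- by move=> x /=; rewrite mulr0 add0r.
- by move=> x /=; rewrite mulr1 addNr.
Qed.

Lemma closed_strip (X : topologicalType) (a b : R) :
  closed [set p : X * R | a <= p.2 <= b].
Proof.
rewrite (_ : [set _ | _] = snd @^-1` [set` `[a, b]]); last first.
  by apply/seteqP; split=> p /=; rewrite in_itv.
apply: closed_comp; last exact: itv_closed.
by move=> p _; exact: continuous_snd.
Qed.

Lemma homotopic_trans (X Y : topologicalType) (f g h : X -> Y) :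
  homotopic f g -> homotopic g h -> homotopic f h.
Proof.
move=> [H [cH H0 H1]] [K [cK K0 K1]].
pose L (p : X * R) : Y :=
  if p.2 <= 2^-1 then H (p.1, 2 * p.2 + 0) else K (p.1, 2 * p.2 + -1).
exists L; split; last 2 first.
- by move=> x; rewrite /L /= ifT ?mulr0 ?addr0 // invr_ge0.
- move=> x; rewrite /L /= ifF; last by apply/negbTE; rewrite -ltNge; lra.
  by rewrite (_ : 2 * 1 + -1 = 1 :> R) ?K1 //; lra.
have -> : [set p : X * R | 0 <= p.2 <= 1] =
    [set p | 0 <= p.2 <= 2^-1] `|` [set p | 2^-1 <= p.2 <= 1].
  apply/seteqP; split=> [[x t] /= /andP[t0 t1]|[x t] /= [] /andP[? ?]].
  - by have [th|th] := leP t 2^-1; [left|right]; apply/andP; split; lra.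
  - by apply/andP; split; lra.
  - by apply/andP; split; lra.
apply: withinU_continuous; [exact: closed_strip|exact: closed_strip| |].
- apply: subspace_eq_continuous (within_comp
    (@continuous_reparam X 2 0) _ cH) => [[x t]|[x t] /= /andP[? ?]].
    by rewrite inE /= => /andP[_ th]; rewrite /from_subspace /L /= th.
  by apply/andP; split; lra.
- apply: subspace_eq_continuous (within_comp
    (@continuous_reparam X 2 (-1)) _ cK) => [[x t]|[x t] /= /andP[? ?]].
    rewrite inE /= => /andP[th _].
    rewrite /from_subspace /L /=; case: ifP => // th'.
    have -> : t = 2^-1 by apply/eqP; rewrite eq_le th' th.
    rewrite (_ : 2 * 2^-1 + -1 = 0 :> R); last by lra.
    by rewrite (_ : 2 * 2^-1 + 0 = 1 :> R) ?H1 ?K0 //; lra.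
  by apply/andP; split; lra.
Qed.

Lemma homotopic_postcomp (X Y Z : topologicalType) (h : Y -> Z) (f g : X -> Y) :
  continuous h -> homotopic f g -> homotopic (h \o f) (h \o g).
Proof.
move=> ch [H [cH H0 H1]]; exists (h \o H); split=> [|x|x] /=.
- exact: comp_within.
- by rewrite H0.
- by rewrite H1.
Qed.

Lemma homotopic_precomp (X Y Z : topologicalType) (h : X -> Y) (f g : Y -> Z) :
  continuous h -> homotopic f g -> homotopic (f \o h) (g \o h).
Proof.
move=> ch [H [cH H0 H1]]; exists (H \o (fun p => (h p.1, p.2))); split=> //=.
apply: within_comp cH; last by move=> [x t].
apply: continuous_pair; last exact: continuous_snd.
exact: (continuous_compT (@continuous_fst X R) ch).
Qed.

Lemma homotopic_comp (X Y Z : topologicalType) (f f' : Y -> Z) (g g' : X -> Y) :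
  continuous f' -> continuous g ->
  homotopic f f' -> homotopic g g' -> homotopic (f \o g) (f' \o g').
Proof.
move=> cf' cg ff' gg'; apply: (@homotopic_trans _ _ _ (f' \o g)).
  exact: homotopic_precomp.
exact: homotopic_postcomp.
Qed.

Definition is_hequiv (X : topologicalType) (f : X -> X) : Prop :=
  continuous f /\
  exists g : X -> X,
    [/\ continuous g, homotopic (g \o f) id & homotopic (f \o g) id].

Definition hequiv (X : topologicalType) : Type :=
  {f : X -> X | f \in [set f | is_hequiv f]}.

Section HomotopyClasses.
Variable X : topologicalType.

HB.instance Definition _ := Choice.on (hequiv X).

Lemma hequivP (f : hequiv X) : is_hequiv (val f).
Proof. by have := valP f; rewrite inE. Qed.

Lemma hequiv_cts (f : hequiv X) : continuous (val f).
Proof. by case: (hequivP f). Qed.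

Definition mkhequiv (f : X -> X) (hf : is_hequiv f) : hequiv X :=
  exist _ f (mem_set hf).

Lemma is_hequiv_id : is_hequiv (@id X).
Proof.
have cid : continuous (@id X) by move=> x; exact: cvg_id.
by split=> //; exists id; split=> //; exact: homotopic_refl.
Qed.

Lemma is_hequiv_comp (f g : X -> X) :
  is_hequiv f -> is_hequiv g -> is_hequiv (f \o g).
Proof.
have cc (u v : X -> X) : continuous u -> continuous v -> continuous (u \o v).
  by move=> cu cv x; apply: continuous_comp; [exact: cv|exact: cu].
move=> [cf [f' [cf' ff ff']]] [cg [g' [cg' gg gg']]].
split; first exact: cc.
exists (g' \o f'); split; first exact: cc.
- apply: homotopic_trans gg; apply: (@homotopic_postcomp _ _ _ g'
    ((f' \o f) \o g) g) => //.
  exact: (@homotopic_precomp _ _ _ g (f' \o f) id).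
- apply: homotopic_trans ff'; apply: (@homotopic_postcomp _ _ _ f
    ((g \o g') \o f') f') => //.
  exact: (@homotopic_precomp _ _ _ f' (g \o g') id).
Qed.

Lemma is_hequiv_inv (f : X -> X) : is_hequiv f ->
  exists2 g : X -> X, is_hequiv g &
    homotopic (g \o f) id /\ homotopic (f \o g) id.
Proof.
by move=> [cf [g [cg gf fg]]]; exists g => //; split=> //; exists f.
Qed.

Definition hequiv_id : hequiv X := mkhequiv is_hequiv_id.
Definition hequiv_comp (f g : hequiv X) : hequiv X :=
  mkhequiv (is_hequiv_comp (hequivP f) (hequivP g)).
Definition hequiv_inv (f : hequiv X) : hequiv X :=
  mkhequiv (s2valP (cid2 (is_hequiv_inv (hequivP f)))).

Lemma hequiv_invP (f : hequiv X) :
  homotopic (val (hequiv_inv f) \o val f) id /\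
  homotopic (val f \o val (hequiv_inv f)) id.
Proof. by rewrite /hequiv_inv /=; case: cid2. Qed.

Definition hrel : rel (hequiv X) := fun f g => `[< homotopic (val f) (val g) >].

Lemma hrel_refl : reflexive hrel.
Proof. by move=> f; apply/asboolP/homotopic_refl/hequiv_cts. Qed.

Lemma hrel_sym : symmetric hrel.
Proof. by move=> f g; apply/asboolP/asboolP => /homotopic_sym. Qed.

Lemma hrel_trans : transitive hrel.
Proof.
by move=> g f h /asboolP fg /asboolP gh; apply/asboolP/(homotopic_trans fg).
Qed.

Canonical hrel_equiv := EquivRel hrel hrel_refl hrel_sym hrel_trans.

End HomotopyClasses.

(* E(X): self-homotopy equivalences up to unpointed homotopy, with the product
   of classes [f] * [g] = [f \o g] (se_mulE). *)
Definition selfEquiv (X : topologicalType) : Type := {eq_quot @hrel_equiv X}.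

Section SelfEquivGroup.
Variable X : topologicalType.

HB.instance Definition _ := Choice.on (selfEquiv X).
HB.instance Definition _ := EqQuotient.on (selfEquiv X).

Definition hpi (f : hequiv X) : selfEquiv X := \pi_(selfEquiv X) f.

Lemma hpiP (f g : hequiv X) : hpi f = hpi g <-> homotopic (val f) (val g).
Proof.
rewrite /hpi; split=> [/eqP|fg]; last apply/eqP.
  by rewrite eqmodE => /asboolP.
by rewrite eqmodE; apply/asboolP.
Qed.

Lemma hpi_repr (a : selfEquiv X) : hpi (repr a) = a.
Proof. exact: reprK. Qed.

Lemma repr_hpi (f : hequiv X) : homotopic (val (repr (hpi f))) (val f).
Proof. by apply/hpiP; exact: hpi_repr. Qed.

Definition se_one : selfEquiv X := hpi (hequiv_id X).
Definition se_mul (a b : selfEquiv X) : selfEquiv X :=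
  hpi (hequiv_comp (repr a) (repr b)).
Definition se_inv (a : selfEquiv X) : selfEquiv X := hpi (hequiv_inv (repr a)).

Lemma se_mulE (f g : hequiv X) :
  se_mul (hpi f) (hpi g) = hpi (hequiv_comp f g).
Proof. by apply/hpiP/homotopic_comp; by [exact: hequiv_cts|exact: repr_hpi]. Qed.

Lemma se_mulA : associative se_mul.
Proof.
move=> a b c; rewrite -[a]hpi_repr -[b]hpi_repr -[c]hpi_repr !se_mulE.
by apply/hpiP/homotopic_refl/hequiv_cts.
Qed.

Lemma se_mul1 : left_id se_one se_mul.
Proof.
move=> a; rewrite -[a]hpi_repr se_mulE.
by apply/hpiP/homotopic_refl/hequiv_cts.
Qed.

Lemma se_mulr1 : right_id se_one se_mul.
Proof.
move=> a; rewrite -[a]hpi_repr se_mulE.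
by apply/hpiP/homotopic_refl/hequiv_cts.
Qed.

Lemma se_mulV : left_inverse se_one se_inv se_mul.
Proof.
move=> a; rewrite -[X in se_mul _ X]hpi_repr se_mulE.
by apply/hpiP; case: (hequiv_invP (repr a)).
Qed.

Lemma se_mulrV : right_inverse se_one se_inv se_mul.
Proof.
move=> a; rewrite -[X in se_mul X _]hpi_repr se_mulE.
by apply/hpiP; case: (hequiv_invP (repr a)).
Qed.

HB.instance Definition _ := isGroup.Build (selfEquiv X)
  se_mulA se_mul1 se_mulr1 se_mulV se_mulrV.

End SelfEquivGroup.

End Homotopy.

(* Main.v *)
Require Import Defs.
From mathcomp Require Import all_boot all_order all_algebra all_fingroup.
From mathcomp Require Import all_classical all_reals all_analysis.
From HB Require Import structures.
From mathcomp Require Import generic_quotient.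

Set Implicit Arguments.
Unset Strict Implicit.
Unset Printing Implicit Defensive.

Import Order.TTheory GRing.Theory Num.Theory numFieldNormedType.Exports.

(** On a finite space the continuous maps are the monotone maps of the
    specialization preorder.  Height 0 means that this preorder is equality;
    then every permutation is a homeomorphism, so Aut is the symmetric group on
    the points ([antichain_Homeo]), and a nonempty space of height 0 realizes
    exactly the groups S_k with k >= 1.

    The passage from Aut to E goes through rigidity: X is [rigid] when no
    continuous self-map other than the identity is comparable with it.  Along a
    homotopy in a finite space, the level maps at times near t lie pointwise
    below the level map at time t, so over a rigid space the times whose level
    map is the identity form a clopen subset of [0, 1].  Hence nothing but the
    identity is homotopic to it, every self-homotopy equivalence is a
    homeomorphism, homotopic ones are equal, and E(X) is Aut(X)
    ([rigid_selfEquiv]).  Antichains are rigid, which settles height 0 for both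
    groups.

    It remains to realize every group G of order n > 1 by a rigid space of
    height 1.  The minimal points are two copies of G and the maximal points,
    called blocks here, are n copies of G.  With G enumerated as
    g_0, ..., g_(n-1), the block (h, j) lies above h in the first copy, and
    above h g_0, ..., h g_j in the second.  Left translations preserve this
    order, and there are no other automorphisms ([frucht_aut]): the index j is
    read off from the number of points below a block, and the nested sets
    {g_0, ..., g_j} separate the elements of G, so that an automorphism acting
    by alpha on the first copy and by beta on the second satisfies
    alpha(h)^-1 beta(x) = h^-1 x for all h and x.  Every block has at least two
    points below it and every minimal point at least two blocks above it, and
    this gives rigidity ([frucht_rigid]). *)

(** * Isomorphisms of groups *)

Section Isomorphic.
Local Open Scope group_scope.

Lemma morph_isomorphic (H K : groupType) (f : H -> K) :
  {morph f : x y / x * y} -> bijective f -> isomorphic H K.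
Proof.
move=> fM fB.
pose F : {multiplicative H -> K} := HB.pack f (isMultiplicative.Build H K f fM).
by exists F.
Qed.

Lemma isomorphic_sym (H K : groupType) : isomorphic H K -> isomorphic K H.
Proof.
move=> [f [g fK gK]]; apply: (@morph_isomorphic _ _ g); last by exists f.
by move=> x y; apply: (can_inj fK); rewrite gmulfM !gK.
Qed.

Lemma isomorphic_trans (H K L : groupType) :
  isomorphic H K -> isomorphic K L -> isomorphic H L.
Proof.
move=> [f fB] [g gB]; apply: (@morph_isomorphic _ _ (g \o f)).
  by move=> x y /=; rewrite !gmulfM.
exact: bij_comp.
Qed.

Lemma isomorphic_perm (S T : finType) (f : S -> T) :
  bijective f -> isomorphic {perm S} {perm T}.
Proof.
move=> [g fK gK].
have inj (s : {perm S}) : injective (f \o s \o g).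
  by move=> x y /= /(can_inj fK)/perm_inj/(can_inj gK).
have inj' (t : {perm T}) : injective (g \o t \o f).
  by move=> x y /= /(can_inj gK)/perm_inj/(can_inj fK).
apply: (@morph_isomorphic _ _ (fun s => perm (inj s))).
  by move=> s t; apply/permP => x; rewrite permM !permE /= fK permM.
exists (fun t => perm (inj' t)) => s; apply/permP => x.
  by rewrite permE /= permE /= !fK.
by rewrite permE /= permE /= !gK.
Qed.

End Isomorphic.

(** * Finite spaces and their specialization preorder *)

Section FiniteSpaces.
Local Open Scope classical_set_scope.

Lemma spec_leP (X : topologicalType) (x y : X) :
  spec_le x y <-> (forall U : set X, open U -> U y -> U x).
Proof.
split=> [xy U oU Uy|h z zx U [oU Uy]].
  by apply: (xy x) => // V [].
by apply: zx; split=> //; exact: h.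
Qed.

Lemma continuous_spec_le (X Y : topologicalType) (f : X -> Y) (x y : X) :
  continuous f -> spec_le x y -> spec_le (f x) (f y).
Proof.
move=> /continuousP cf /spec_leP xy; apply/spec_leP => U oU Ufy.
exact: (xy (f @^-1` U) (cf _ oU)).
Qed.

(** Finitely many neighbourhoods of x suffice to exclude all the points that are
    not below x; equivalently, the minimal open set of x is open. *)
Lemma near_spec_le (X : finTopologicalType) (x : X) :
  \forall y \near x, spec_le y x.
Proof.
have: \forall y \near x, forall z, y = z -> spec_le z x.
  apply: filter_forall => z; have [zx|nzx] := pselect (spec_le z x).
    by apply: filterE => y _.
  have [U [oU [Ux nUz]]] : exists U : set X, open U /\ U x /\ ~ U z.
    apply: contrapT => h; apply: nzx; apply/spec_leP => U oU Ux.
    by apply: contrapT => nUz; apply: h; exists U.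
  apply: filterS (open_nbhs_nbhs (conj oU Ux)) => y Uy yz.
  by case: nUz; rewrite -yz.
by apply: filterS => y; exact.
Qed.

Lemma spec_le_continuous (X : finTopologicalType) (Y : topologicalType)
    (f : X -> Y) :
  (forall x y, spec_le x y -> spec_le (f x) (f y)) -> continuous f.
Proof.
move=> fle x W; rewrite /= nbhsE => -[V [oV Vfx] VW].
rewrite nbhs_filterE; apply: filterS (near_spec_le x) => y /fle/spec_leP h.
by apply: VW; exact: h.
Qed.

(** For a finite T0 space this is the absence of beat points: a minimal finite
    space in the sense of Stong. *)
Definition rigid (X : topologicalType) : Prop :=
  forall f : X -> X, continuous f ->
    (forall x, spec_le (f x) x) \/ (forall x, spec_le x (f x)) -> f =1 id.

(** * Homotopies on rigid finite spaces *)

Section Homotopies.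
Variable R : realType.

(** The value at time t is contained in its minimal open set, which therefore
    contains the values at all nearby times. *)
Lemma homotopy_near (X : topologicalType) (Y : finTopologicalType)
    (H : X * R -> Y) (x : X) (t : R) :
  {within [set p : X * R | (0 <= p.2 <= 1)%R], continuous H} ->
  (0 <= t <= 1)%R ->
  \forall s \near t, (0 <= s <= 1)%R -> spec_le (H (x, s)) (H (x, t)).
Proof.
move=> /(@subspace_continuousP _ _) cH t01.
have cx : continuous (fun s : R => (x, s)).
  by apply: continuous_pair => s; [exact: cvg_cst|exact: cvg_id].
exact: (cx t _ (cH (x, t) t01 _ (near_spec_le (H (x, t))))).
Qed.

Lemma homotopy_level (X Y : topologicalType) (H : X * R -> Y) (t : R) :
  {within [set p : X * R | (0 <= p.2 <= 1)%R], continuous H} ->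
  (0 <= t <= 1)%R -> continuous (fun x => H (x, t)).
Proof.
move=> cH t01; apply/continuous_subspace_setT.
apply: (within_comp _ _ cH) => [|x _] //.
by apply: continuous_pair => [x|x]; [exact: cvg_id|exact: cvg_cst].
Qed.

(** The set B of the times at which the homotopy is the identity is clopen in
    [0, 1]: nearby level maps are comparable, and by rigidity a map comparable
    with the identity is the identity. *)
Lemma rigid_homotopic_id (X : finTopologicalType) (f : X -> X) :
  rigid X -> homotopic R id f -> f =1 id.
Proof.
move=> rX [H [cH H0 H1]].
pose A : set R := `[0%R, 1%R].
have AE t : A t = (0 <= t <= 1)%R :> Prop by rewrite /A /= in_itv.
pose B : set R := [set t | A t /\ forall x, H (x, t) = x].
have Hstep s t : A s -> A t ->
    (forall x, spec_le (H (x, s)) (H (x, t))) -> (B s <-> B t).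
  move=> As At st.
  have cs : continuous (fun x => H (x, s)).
    by apply: homotopy_level => //; rewrite -AE.
  have ct : continuous (fun x => H (x, t)).
    by apply: homotopy_level => //; rewrite -AE.
  split=> -[_ h]; split=> // x.
    by apply: (rX _ ct) => {}; right=> z; rewrite -[X in spec_le X _]h.
  by apply: (rX _ cs) => {}; left=> z; rewrite -[X in spec_le _ X]h.
have Bnear t : A t -> \forall s \near t, A s -> (B s <-> B t).
  move=> At; have At' : (0 <= t <= 1)%R by rewrite -AE.
  apply: filterS (filter_forall _ (fun x => homotopy_near x cH At')) => s h As.
  by apply: Hstep => // x; apply: h; rewrite -AE.
have BA : B = A.
  apply: (@segment_connected R 0%R 1%R B).
  - exists 0%R; split; last exact: H0.
    by rewrite AE lexx ler01.
  - exists (interior [set s | A s -> B s]); first exact: open_interior.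
    apply/seteqP; split=> t; last by move=> [At /interior_subset]; exact.
    move=> Bt; have At := Bt.1; split=> //.
    by apply: filterS (Bnear t At) => s h As; apply/h.
  - exists (~` interior [set s | A s -> ~ B s]).
      by apply: open_closedC; exact: open_interior.
    apply/seteqP; split=> t.
      by move=> Bt; split; [exact: Bt.1|move/interior_subset => /(_ Bt.1)].
    move=> [At nt]; apply: contrapT => nBt; apply: nt.
    by apply: filterS (Bnear t At) => s h As /(h As).
have : B 1%R by rewrite BA AE ler01 lexx.
by move=> [_ h] x; rewrite -H1 h.
Qed.

(** A homotopy inverse is an inverse, since both composites are homotopic to the
    identity; applying the inverse of f to a homotopy from f to f' gives a
    homotopy from the identity, whence f = f'. *)
Lemma rigid_selfEquiv (X : finTopologicalType) :
  rigid X -> isomorphic (Homeo X) (selfEquiv R X).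
Proof.
move=> rX.
have h2e (f : Homeo X) : is_hequiv R (val f).
  have [cf [g [cg fK gK]]] := HomeoP f; split=> //; exists g; split=> //.
    by rewrite (_ : g \o val f = id);
      [apply/homotopic_refl => x; exact: cvg_id|apply/funext].
  by rewrite (_ : val f \o g = id);
    [apply/homotopic_refl => x; exact: cvg_id|apply/funext].
have inj : injective (fun f : Homeo X => hpi (mkhequiv (h2e f))).
  move=> f f' /hpiP /= ff'; apply: Homeo_eq.
  have [cf [g [cg fK gK]]] := HomeoP f.
  have: homotopic R (g \o val f) (g \o val f') by exact: homotopic_postcomp.
  rewrite (_ : g \o val f = id); last exact/funext.
  by move=> /(rigid_homotopic_id rX) h x; rewrite -[RHS]gK [g _]h.
have surj (a : selfEquiv R X) : exists f, hpi (mkhequiv (h2e f)) = a.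
  have [cf [g [cg gf fg]]] := hequivP (repr a).
  have hf : is_homeo (val (repr a)).
    split=> //; exists g; split=> //.
      exact: (rigid_homotopic_id rX (homotopic_sym gf)).
    exact: (rigid_homotopic_id rX (homotopic_sym fg)).
  exists (mkHomeo hf); rewrite -[RHS]hpi_repr; apply/hpiP.
  exact: homotopic_refl.
apply: (@morph_isomorphic _ _ (fun f : Homeo X => hpi (mkhequiv (h2e f)))).
  move=> f g; rewrite [RHS]se_mulE; apply/hpiP; apply: homotopic_refl.
  exact: hequiv_cts.
pose inv a := sval (cid (surj a)).
have invK a : hpi (mkhequiv (h2e (inv a))) = a := svalP (cid (surj a)).
by exists inv => // f; apply: inj; exact: invK.
Qed.

End Homotopies.

(** * Spaces of height 0 *)

Definition antichain (X : topologicalType) : Prop :=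
  forall x y : X, spec_le x y -> x = y.

Lemma antichain_rigid (X : topologicalType) : antichain X -> rigid X.
Proof. by move=> aX f _ [] h x; [apply: aX|apply/esym/aX]. Qed.

(** Permutations compose from left to right and homeomorphisms from right to
    left, so the isomorphism sends s to the inverse of s. *)
Lemma antichain_Homeo (X : finTopologicalType) :
  antichain X -> isomorphic {perm 'I_#|X|} (Homeo X).
Proof.
move=> aX.
apply: (@isomorphic_trans _ {perm X}).
  exact: (isomorphic_perm (enum_val_bij X)).
have ctsX (f : X -> X) : continuous f.
  by apply: spec_le_continuous => x y /aX ->.
have hs (s : {perm X}) : is_homeo (s^-1)%g.
  by split=> //; exists s; split=> // x; rewrite ?permK ?permKV.
have hinj (f : Homeo X) : injective (val f).
  by have [_ [g [_ fK _]]] := HomeoP f; exact: can_inj fK.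
apply: (@morph_isomorphic _ _ (fun s => mkHomeo (hs s))).
  by move=> s t; apply: Homeo_eq => x /=; rewrite invMg permM.
exists (fun f => (perm (@hinj f))^-1)%g => [s|f].
  by apply/permP => x; congr (fun_of_perm _ x); apply: invg_inj;
    apply/permP => y; rewrite invgK permE.
by apply: Homeo_eq => x /=; rewrite invgK permE.
Qed.

Lemma chain_leq_ht (X : finTopologicalType) (A : {set X}) :
  chain A -> (#|A|.-1 <= ht X)%N.
Proof.
move=> cA; rewrite /ht -!subn1; apply: leq_sub2r.
by apply: leq_bigmax_cond; apply/asboolP.
Qed.

Lemma ht_leq (X : finTopologicalType) (n : nat) :
  (forall A : {set X}, chain A -> #|A| <= n.+1)%N -> (ht X <= n)%N.
Proof.
move=> h; rewrite /ht -subn1 leq_subLR add1n.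
by apply/bigmax_leqP => A /asboolP; exact: h.
Qed.

Lemma lt_ht (X : finTopologicalType) (x y : X) :
  spec_le x y -> x <> y -> (0 < ht X)%N.
Proof.
move=> xy /eqP nxy.
apply: (leq_trans _ (@chain_leq_ht X [set x; y] _)); first by rewrite cards2 nxy.
move=> u v; rewrite !inE => /orP[]/eqP-> /orP[]/eqP->; by [left|right].
Qed.

Lemma ht0P (X : finTopologicalType) : ht X = 0%N <-> antichain X.
Proof.
split=> [hX x y xy|aX].
  by apply: contrapT => /(lt_ht xy); rewrite hX.
apply/eqP; rewrite -leqn0; apply: ht_leq => A cA.
by apply/card_le1_eqP => x y xA yA; case: (cA x y xA yA) => /aX->.
Qed.

Lemma ht0_Homeo (X : finTopologicalType) :
  [set: X] !=set0 -> ht X = 0%N ->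
  exists2 k : nat, (1 <= k)%N & isomorphic {perm 'I_k} (Homeo X).
Proof.
move=> [x _] /ht0P aX; exists #|X|; last exact: antichain_Homeo.
by apply/card_gt0P; exists x.
Qed.

End FiniteSpaces.

(** * The finite space of a preorder *)

Section Alexandrov.
Local Open Scope classical_set_scope.

(** A copy of T whose type carries r, so that the topology of the r-down-closed
    sets can be attached to it. *)
Definition alexandrov (T : finType) (r : rel T) : Type := T.

Variables (T : finType) (r : rel T).

HB.instance Definition _ := Finite.on (alexandrov r).

Definition down_closed (U : set T) : Prop := forall x y, r x y -> U y -> U x.

Lemma down_closedT : down_closed setT. Proof. by []. Qed.

Lemma down_closedI : setI_closed down_closed.
Proof. by move=> U V dU dV x y xy [/(dU _ _ xy) ? /(dV _ _ xy) ?]. Qed.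

Lemma down_closed_bigU (I : Type) (U : I -> set T) :
  (forall i, down_closed (U i)) -> down_closed (\bigcup_i U i).
Proof. by move=> dU x y xy [i _ /(dU i _ _ xy) Ux]; exists i. Qed.

HB.instance Definition _ := isOpenTopological.Build (alexandrov r)
  down_closedT down_closedI down_closed_bigU.

Lemma alexandrov_open (U : set (alexandrov r)) : open U = down_closed U.
Proof. by []. Qed.

Hypotheses (r_refl : reflexive r) (r_trans : transitive r).

Lemma alexandrov_spec_le (x y : alexandrov r) : spec_le x y <-> r x y.
Proof.
split=> [/spec_leP xy|xy].
  apply: (xy [set z : T | r z y]); last exact: r_refl.
  by rewrite alexandrov_open => u v uv; exact: r_trans.
by apply/spec_leP => U; rewrite alexandrov_open => /(_ x y xy).
Qed.

Lemma alexandrov_kolmogorov :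
  antisymmetric r -> kolmogorov_space (alexandrov r).
Proof.
move=> r_anti x y nxy.
have sep (u v : alexandrov r) : ~~ r v u ->
    [set z : alexandrov r | r z u] \in nbhs u /\
    v \in ~` [set z : alexandrov r | r z u].
  move=> nvu; rewrite !inE; split; last exact/negP.
  apply: open_nbhs_nbhs; split; last exact: r_refl.
  by rewrite alexandrov_open => a b ab; exact: r_trans.
have [yx|nyx] := boolP (r y x); last by exists [set z | r z x]; left; exact: sep.
exists [set z | r z y]; right; apply: sep; apply: contra nxy => xy.
by apply/eqP/r_anti; rewrite xy.
Qed.

End Alexandrov.

(** * A height 1 poset with automorphism group G *)

Section Frucht.
Local Open Scope group_scope.
Variable G : finGroupType.

(** Both copies of G among the minimal points are tagged [inl], the first one with
    [true]; [inr j] tags the blocks of index j. *)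
Definition frucht_point : finType := (G * (bool + 'I_#|G|))%type.

(** A block of index j lies above one point of the first copy and above j + 1
    points of the second.  The first copy tells apart the blocks with the same
    trace on the second one, which exist as soon as a set {g_0, ..., g_j} has a
    nontrivial left stabilizer. *)
Definition frucht_lt : rel frucht_point := fun x y =>
  match x.2, y.2 with
  | inl true, inr _ => x.1 == y.1
  | inl false, inr j => (enum_rank (y.1^-1 * x.1)%g <= j)%N
  | _, _ => false
  end.

Definition frucht_le : rel frucht_point := fun x y => (x == y) || frucht_lt x y.

Lemma frucht_ltW x y : frucht_lt x y -> frucht_le x y.
Proof. by rewrite /frucht_le orbC => ->. Qed.

Lemma frucht_lt_trans_false x y z : frucht_lt x y -> frucht_lt y z -> false.
Proof.
by case: x y z => [g [[]|i]] [h [[]|j]] [k [[]|l]].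
Qed.

Lemma frucht_lt_irrefl x : frucht_lt x x = false.
Proof. by case: x => [g [[]|i]]. Qed.

Lemma frucht_le_refl : reflexive frucht_le.
Proof. by move=> x; rewrite /frucht_le eqxx. Qed.

Lemma frucht_le_trans : transitive frucht_le.
Proof.
move=> y x z /predU1P[-> //|xy] /predU1P[<-|yz]; first exact/predU1r.
by have := frucht_lt_trans_false xy yz.
Qed.

Lemma frucht_le_anti : antisymmetric frucht_le.
Proof.
move=> x y /andP[/predU1P[//|xy] /predU1P[//|yx]].
by have := frucht_lt_trans_false xy yx.
Qed.

Definition frucht_shift (a : G) (x : frucht_point) : frucht_point :=
  (a * x.1, x.2).

Lemma frucht_shiftK a : cancel (frucht_shift a) (frucht_shift a^-1).
Proof. by case=> g c; rewrite /frucht_shift mulKg. Qed.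

Lemma frucht_shiftVK a : cancel (frucht_shift a^-1) (frucht_shift a).
Proof. by case=> g c; rewrite /frucht_shift mulKVg. Qed.

Lemma frucht_shift_lt a x y :
  frucht_lt (frucht_shift a x) (frucht_shift a y) = frucht_lt x y.
Proof.
case: x y => [g [[]|i]] [h [[]|j]] //; rewrite /frucht_lt /=.
  by rewrite (inj_eq (mulgI a)).
by rewrite invMg -mulgA mulKg.
Qed.

Lemma frucht_shift_le a x y :
  frucht_le (frucht_shift a x) (frucht_shift a y) = frucht_le x y.
Proof.
by rewrite /frucht_le frucht_shift_lt (can_eq (frucht_shiftK a)).
Qed.

Definition below (y : frucht_point) : {set frucht_point} :=
  [set x | frucht_lt x y].

Lemma card_below_aut (f : frucht_point -> frucht_point) y :
  bijective f -> {mono f : x y / frucht_lt x y} -> #|below (f y)| = #|below y|.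
Proof.
move=> fB fM; rewrite -(card_imset (below y) (bij_inj fB)).
congr #|pred_of_set _|.
have [g fK gK] := fB; apply/setP => x; rewrite inE.
apply/idP/imsetP => [xy|[z]]; last by rewrite inE => zy ->; rewrite fM.
by exists (g x); rewrite ?gK // inE -fM gK.
Qed.

Lemma card_below_point g b : #|below (g, inl b)| = 0.
Proof.
apply/eqP; rewrite cards_eq0.
by apply/eqP/setP => -[h [[]|i]]; rewrite !inE.
Qed.

Lemma card_below_block g j : (0 < #|below (g, inr j)|)%N.
Proof. by apply/card_gt0P; exists (g, inl true); rewrite inE /frucht_lt /=. Qed.

(** The sets {g_0, ..., g_j} are nested, and g_k enters at the index k. *)
Lemma card_below_lt (j k : 'I_#|G|) : (j < k)%N ->
  (#|below (1%g, inr j)| < #|below (1%g, inr k)|)%N.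
Proof.
move=> jk; apply/proper_card/properP; split.
  apply/fintype.subsetP => -[g [[]|i]]; rewrite !inE /frucht_lt //= => gj.
  exact: leq_trans gj (ltnW jk).
exists (enum_val k, inl false); rewrite !inE /frucht_lt /= invg1 mul1g enum_valK //.
by rewrite -ltnNge.
Qed.

(** Left translation reduces the comparison of two blocks to the case of the
    blocks over 1. *)
Lemma card_below_inj g h j k :
  #|below (g, inr j)| = #|below (h, inr k)| -> j = k.
Proof.
have toone a i : #|below (a, inr i)| = #|below (1%g, inr i)|.
  rewrite -(card_below_aut (f := frucht_shift a) (1, inr i)).
  - by rewrite /frucht_shift mulg1.
  - by exists (frucht_shift a^-1); [exact: frucht_shiftK|exact: frucht_shiftVK].
  - exact: frucht_shift_lt.
rewrite (toone g) (toone h) => E.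
by case: (ltngtP j k) => [/card_below_lt|/card_below_lt|/val_inj //];
  rewrite E ltnn.
Qed.

Hypothesis G_gt1 : (1 < #|G|)%N.

(* The blocks of this index lie above the whole second copy of G. *)
Let top : 'I_#|G| := Ordinal (eq_leq (ltn_predK G_gt1)).

Lemma below_top g h : frucht_lt (g, inl false) (h, inr top).
Proof. by rewrite /frucht_lt /= -ltnS (ltn_predK G_gt1). Qed.

Lemma other_elt (g : G) : exists h, h != g.
Proof.
have /card_gt0P[h] : (0 < #|predC1 g|)%N by rewrite cardC1 -subn1 subn_gt0.
by exists h.
Qed.

(** The number of points below shows that f preserves the index of a block and
    maps minimal points to minimal points.  The two copies of G are not exchanged:
    a point of the second copy is below every block of top index, while a point
    of the first copy is below only one.  Writing al and be for the actions of f
    on the two copies, the blocks are permuted according to al, and incidence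
    with the blocks of index j says that the rank of (al h)^-1 (be x) is at most
    j exactly when that of h^-1 x is; over all j this gives
    (al h)^-1 (be x) = h^-1 x. *)
Lemma frucht_aut (f : frucht_point -> frucht_point) :
  bijective f -> {mono f : x y / frucht_lt x y} ->
  exists a, f =1 frucht_shift a.
Proof.
move=> fB fM; have fI := bij_inj fB.
have f_block g j : exists h, f (g, inr j) = (h, inr j).
  have := card_below_aut (g, inr j) fB fM; case: (f _) => h [b|k].
    by rewrite card_below_point => E; have := card_below_block g j; rewrite -E.
  by move=> /card_below_inj ->; exists h.
have f_point g b : exists h c, f (g, inl b) = (h, inl c).
  have := card_below_aut (g, inl b) fB fM; case: (f _) => h [c|k].
    by exists h, c.
  by rewrite card_below_point => E; have := card_below_block h k; rewrite E.
(* The image of (g, inl true) cannot be below all the blocks of top index. *)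
have f_true g : exists h, f (g, inl true) = (h, inl true).
  have [h [[]]] := f_point g true; first by exists h.
  move=> E; have [k /eqP nkg] := other_elt g; case: nkg.
  have [l El] := f_block k top.
  by have := below_top h l; rewrite -E -El fM /frucht_lt /= => /eqP.
(* The image of (g, inl false) cannot be below only one block of top index. *)
have f_false g : exists h, f (g, inl false) = (h, inl false).
  have [h [[]]] := f_point g false; last by exists h.
  move=> E; have [k /eqP nk1] := other_elt 1; case: nk1.
  have topE l : f (l, inr top) = (h, inr top).
    have [m Em] := f_block l top.
    by have := below_top g l; rewrite -fM E Em /frucht_lt /= => /eqP->.
  by have : f (k, inr top) = f (1, inr top); [rewrite !topE|move=> /fI[]].
pose al g := (f (g, inl true)).1; pose be g := (f (g, inl false)).1.
have alE g : f (g, inl true) = (al g, inl true).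
  by have [h E] := f_true g; rewrite /al E.
have beE g : f (g, inl false) = (be g, inl false).
  by have [h E] := f_false g; rewrite /be E.
have blE g j : f (g, inr j) = (al g, inr j).
  have [h E] := f_block g j; have := fM (g, inl true) (g, inr j).
  by rewrite E alE /frucht_lt /= eqxx => /eqP->.
have rankE h x (j : 'I_#|G|) :
    (enum_rank ((al h)^-1 * be x)%g <= j)%N = (enum_rank (h^-1 * x)%g <= j)%N.
  by have := fM (x, inl false) (h, inr j); rewrite beE blE.
have al_be h x : (al h)^-1 * be x = h^-1 * x.
  apply: enum_rank_inj; apply/val_inj/eqP; rewrite eqn_leq.
  by rewrite rankE leqnn -rankE leqnn.
have be1 x : be x = al 1 * x.
  by have := al_be 1 x; rewrite invg1 mul1g => {2}<-; rewrite mulKVg.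
have al1 x : al x = al 1 * x.
  have := al_be x x; rewrite mulVg => /eqP; rewrite -eq_mulVg1 => /eqP->.
  exact: be1.
exists (al 1) => -[g [[]|j]]; rewrite ?alE ?beE ?blE /frucht_shift /=.
- by rewrite -al1.
- by rewrite -be1.
- by rewrite -al1.
Qed.

Definition frucht_space : finTopologicalType := alexandrov frucht_le.

Lemma frucht_spec_le (x y : frucht_space) : spec_le x y <-> frucht_le x y.
Proof.
exact: (@alexandrov_spec_le _ _ frucht_le_refl frucht_le_trans x y).
Qed.

Lemma frucht_Homeo : isomorphic (Homeo frucht_space) G.
Proof.
apply: isomorphic_sym.
have cts a : continuous (frucht_shift a : frucht_space -> frucht_space).
  apply: spec_le_continuous => x y /frucht_spec_le xy.
  by apply/frucht_spec_le; rewrite frucht_shift_le.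
have hs a : is_homeo (frucht_shift a : frucht_space -> frucht_space).
  split=> //; exists (frucht_shift a^-1).
  by split=> //; [exact: frucht_shiftK|exact: frucht_shiftVK].
have surj (f : Homeo frucht_space) : exists a, val f =1 frucht_shift a.
  have [cf [g [cg fK gK]]] := HomeoP f; apply: frucht_aut; first by exists g.
  have mono x y : frucht_le (val f x) (val f y) = frucht_le x y.
    apply/idP/idP => /frucht_spec_le.
      by move=> /(continuous_spec_le cg); rewrite !fK => /frucht_spec_le.
    by move=> /(continuous_spec_le cf)/frucht_spec_le.
  have ltE x y : frucht_lt x y = (x != y) && frucht_le x y.
    rewrite /frucht_le; case: eqVneq => //= ->; exact: frucht_lt_irrefl.
  by move=> x y; rewrite !ltE mono (can_eq fK).
apply: (@morph_isomorphic _ _ (fun a => mkHomeo (hs a))).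
  by move=> a b; apply: Homeo_eq => x; rewrite /= /frucht_shift mulgA.
pose dec f := sval (cid (surj f)).
have decP (f : Homeo frucht_space) : val f =1 frucht_shift (dec f).
  exact: svalP (cid (surj f)).
exists dec => [a|f]; last by apply: Homeo_eq => x; exact: esym (decP f x).
have /= := decP (mkHomeo (hs a)) (1, inl true).
by rewrite /frucht_shift /= !mulg1 => -[].
Qed.

(** A map below the identity fixes the minimal points; if it lowered a block to a
    point x, then by monotonicity x would be the only point below that block.
    Dually, a map above the identity fixes the blocks, and a point that it raised
    would be below a single block. *)
Lemma frucht_rigid : rigid frucht_space.
Proof.
move=> f cf.
have mono (x y : frucht_space) : frucht_le x y -> frucht_le (f x) (f y).
  by move=> /frucht_spec_le/(continuous_spec_le cf)/frucht_spec_le.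
case=> [dn|up].
- have fmin g b : f (g, inl b) = (g, inl b).
    have /frucht_spec_le := dn (g, inl b).
    by case/predU1P => //; case: (f _) => h [[]|].
  case=> g [b|j]; first exact: fmin.
  have /frucht_spec_le/predU1P[//|] := dn (g, inr j).
  case E : (f _) => [h [c|k]] // _.
  have fix_below z b : frucht_lt (z, inl b) (g, inr j) ->
      (z, inl b) = (h, inl c) :> frucht_point.
    move=> zj; have := mono (z, inl b) (g, inr j) (frucht_ltW zj).
    by rewrite E fmin => /predU1P[//|]; case: (b).
  have c_true : true = c.
    by have := fix_below g true; rewrite /frucht_lt /= eqxx => /(_ isT)[].
  (* g times the first element of G is below every block over g. *)
  have := fix_below (g * enum_val (Ordinal (ltnW G_gt1))) false.
  by rewrite /frucht_lt /= mulKg enum_valK -c_true => /(_ isT).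
- have fmax g j : f (g, inr j) = (g, inr j).
    have /frucht_spec_le := up (g, inr j).
    by case/predU1P => // /esym; case: (f _) => h [[]|].
  case=> g [b|j]; last exact: fmax.
  have /frucht_spec_le/predU1P[//|] := up (g, inl b).
  case E : (f _) => [h [c|k]]; first by case: (b).
  move=> _.
  have fix_above z j : frucht_lt (g, inl b) (z, inr j) ->
      (z, inr j) = (h, inr k) :> frucht_point.
    move=> zj; have := mono (g, inl b) (z, inr j) (frucht_ltW zj).
    by rewrite E fmax => /predU1P[//|].
  case: b E fix_above => _ fix_above; exfalso.
  + have jE j : j = k.
      by have := fix_above g j; rewrite /frucht_lt /= eqxx => /(_ isT)[].
    have := jE top; rewrite -(jE (Ordinal (ltnW G_gt1))) => /(congr1 val) /= E.
    by move: G_gt1; rewrite -(ltn_predK G_gt1) E.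
  + have [l /eqP nl] := other_elt 1; apply: nl.
    have [-> _] := fix_above l top (below_top g l).
    by have [-> _] := fix_above 1 top (below_top g 1).
Qed.

(** A chain contains at most one block and at most one minimal point. *)
Lemma frucht_ht : ht frucht_space = 1%N.
Proof.
apply/eqP; rewrite eqn_leq; apply/andP; split.
  apply: ht_leq => A cA.
  pose blk (x : frucht_space) := if x.2 is inr _ then true else false.
  rewrite -card_bool; apply: leq_trans (max_card (mem (blk @: A))).
  rewrite card_in_imset // => x y xA yA bxy.
  by case: (cA x y xA yA) => /frucht_spec_le/predU1P[//|];
    move: bxy; case: x y {xA yA} => [g [[]|i]] [h [[]|j]].
apply: (@lt_ht frucht_space (1, inl true) (1, inr top)) => //.
by apply/frucht_spec_le/frucht_ltW; rewrite /frucht_lt /=.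
Qed.

End Frucht.

(** * Minimal heights *)

Lemma ht0_realizer (k : nat) : (1 <= k)%N ->
  exists X : finTopologicalType,
    [/\ kolmogorov_space X, ([set: X] !=set0)%classic,
        isomorphic {perm 'I_k} (Homeo X), rigid X & ht X = 0%N].
Proof.
move=> k0; pose X : finTopologicalType := alexandrov (@eq_op 'I_k).
have r_refl : reflexive (@eq_op 'I_k) by [].
have r_trans : transitive (@eq_op 'I_k) by move=> ? ? ? /eqP-> /eqP->.
have aX : antichain X.
  by move=> x y /(alexandrov_spec_le r_refl r_trans)/eqP.
exists X; split.
- by apply: alexandrov_kolmogorov => // x y /andP[/eqP].
- by exists (Ordinal k0).
- by have := antichain_Homeo aX; rewrite card_ord.
- exact: antichain_rigid.
- exact/ht0P.
Qed.

Theorem mainTheorem3 (R : realType) (G : finGroupType) :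
  ((exists2 k : nat, (1 <= k)%N & isomorphic G {perm 'I_k}) ->
     min_height (fun X => isomorphic (Homeo X) G) 0 /\
     min_height (fun X => isomorphic (selfEquiv R X) G) 0) /\
  (~ (exists2 k : nat, (1 <= k)%N & isomorphic G {perm 'I_k}) ->
     min_height (fun X => isomorphic (Homeo X) G) 1 /\
     min_height (fun X => isomorphic (selfEquiv R X) G) 1).
Proof.
split=> [[k k0 Gk]|nG].
  have [X [X_T0 X0 kX rX hX]] := ht0_realizer k0.
  have XG : isomorphic (Homeo X) G.
    exact/isomorphic_sym/(isomorphic_trans Gk).
  split; split=> //; exists X; split=> //.
  exact: isomorphic_trans (isomorphic_sym (rigid_selfEquiv R rX)) XG.
have G_gt1 : (1 < #|G|)%N.
  rewrite ltnNge; apply/negP => /card_le1_eqP G1; apply: nG; exists 1%N => //.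
  apply: (@morph_isomorphic _ _ (fun=> 1%g)) => [x y|]; first by rewrite mulg1.
  by exists (fun=> 1%g) => [x|s]; [exact: G1|apply/permP => i; rewrite !ord1].
have Homeo_lb (X : finTopologicalType) : ([set: X] !=set0)%classic ->
    isomorphic (Homeo X) G -> (1 <= ht X)%N.
  move=> X0 XG; rewrite lt0n; apply/eqP => /(ht0_Homeo X0)[k k0 kX].
  by apply: nG; exists k => //; apply/isomorphic_sym/(isomorphic_trans kX).
have FG := frucht_Homeo G_gt1; have rF := frucht_rigid G_gt1.
have F0 : ([set: frucht_space G] !=set0)%classic.
  by exists (1%g, inl true).
have F_T0 : kolmogorov_space (frucht_space G).
  apply: alexandrov_kolmogorov; [exact: frucht_le_refl|exact: frucht_le_trans|
    exact: frucht_le_anti].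
split; split=> [|X _ X0 XG].
- by exists (frucht_space G); split=> //; exact: frucht_ht.
- exact: Homeo_lb.
- exists (frucht_space G); split=> //; last exact: frucht_ht.
  exact: isomorphic_trans (isomorphic_sym (rigid_selfEquiv R rF)) FG.
- rewrite lt0n; apply/eqP => hX.
  have aX : antichain X by apply/ht0P.
  suff : (1 <= ht X)%N by rewrite hX.
  apply: Homeo_lb => //.
  exact: isomorphic_trans (rigid_selfEquiv R (antichain_rigid aX)) XG.
Qed.
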